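(* Let $G=(V,E)$ be a directed graph. If $K_n\not\subset\widetilde G$ for some integer $n\ge 2$, then $G\in\mathfrak{In}_2\text{-}\mathfrak{Out}_2$. Moreover, if $n=2$ (i.e. $\widetilde G$ has no edges), then $G\in\mathfrak{Out}_2\cup(\mathfrak{In}_1\text{-}\mathfrak{Out}_1)$; and if $n=3$ (i.e. $\widetilde G$ is triangle-free), then $G\in\mathfrak{In}_1\text{-}\mathfrak{Out}_2$ or $G\in\mathfrak{In}_2\text{-}\mathfrak{Out}_1$.
   Context: Digraphs $G=(V,E)$, $E\subseteq V\times V$, may be infinite. The undirected complement of $G$ is the undirected graph $\widetilde G=(V,\widetilde E)$ where, for distinct $x,y\in V$, $\{x,y\}\in\widetilde E$ iff $(x,y)\notin E$ and $(y,x)\notin E$. $K_n$ is the complete graph on $n$ vertices, and $K_n\not\subset\widetilde G$ means $\widetilde G$ has no subgraph isomorphic to $K_n$. For $W\subseteq V$, $G[W]=(W,E\cap (W\times W))$ is the induced subgraph. A set $A\subseteq V$ is independent if there is no edge (in either direction) of $G$ between two distinct elements of $A$. For $n\in\mathbb N$ and $A\subseteq V$, $\mathrm{Out}^G_n(A)$ (resp. $\mathrm{In}^G_n(A)$) is the set of all $v\in V$ such that there is a directed path of length at most $n$ from some point of $A$ to $v$ (resp. from $v$ to some point of $A$); length $0$ is allowed. $G\in\mathfrak{Out}_n$ (resp. $G\in\mathfrak{In}_n$) iff there is an independent $A\subseteq V$ with $V=\mathrm{Out}^G_n(A)$ (resp. $V=\mathrm{In}^G_n(A)$). $G\in\mathfrak{In}_n\text{-}\mathfrak{Out}_k$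 iff there is a partition $(V_1,V_2)$ of $V$ (parts may be empty) with $G[V_1]\in\mathfrak{In}_n$ and $G[V_2]\in\mathfrak{Out}_k$. *)

(* Defs.v *)
From mathcomp Require Import all_boot all_classical.

Set Implicit Arguments.
Unset Strict Implicit.
Unset Printing Implicit Defensive.

Local Open Scope classical_set_scope.

(* Vertex sets are arbitrary types, possibly infinite; loops are allowed. *)
Record digraph := Digraph {
  vertex :> Type;
  edge : vertex -> vertex -> Prop
}.

Record ugraph := UGraph {
  uvertex :> Type;
  adj : uvertex -> uvertex -> Prop;
  adj_sym : forall x y, adj x y -> adj y x;
  adj_irrefl : forall x, ~ adj x x
}.

Section Complement.
Variable G : digraph.

Definition compl_adj (x y : G) : Prop := [/\ x <> y, ~ edge x y & ~ edge y x].

Lemma compl_adj_sym (x y : G) : compl_adj x y -> compl_adj y x.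
Proof. by case=> xy nxy nyx; split=> // yx; apply: xy. Qed.

Lemma compl_adj_irrefl (x : G) : ~ compl_adj x x.
Proof. by case=> /(_ erefl). Qed.

Definition undirected_complement : ugraph :=
  UGraph compl_adj_sym compl_adj_irrefl.

End Complement.

Section Complete.
Variable n : nat.

Lemma neq_ord_sym (i j : 'I_n) : i <> j -> j <> i.
Proof. by move=> ij ji; apply: ij. Qed.

Lemma neq_ord_irrefl (i : 'I_n) : ~ i <> i.
Proof. by move=> /(_ erefl). Qed.

Definition complete_graph : ugraph := UGraph neq_ord_sym neq_ord_irrefl.

End Complete.

(* [H] is isomorphic to a (not necessarily induced) subgraph of [G]. *)
Definition has_copy (H G : ugraph) : Prop :=
  exists2 f : H -> G, injective f & forall x y, adj x y -> adj (f x) (f y).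

Definition induced (G : digraph) (W : set G) : digraph :=
  @Digraph (set_type W) (fun x y => edge (val x) (val y)).

Definition independent (G : digraph) (A : set G) : Prop :=
  forall x y, A x -> A y -> x <> y -> ~ edge x y.

(* The path visits x, then the vertices of [p] in order, without repetition;
   its length is its number of edges, [size p].  The type [{classic G}] is [G]
   with its classical decidable equality, as needed by [uniq]. *)
Definition dipath_upto (G : digraph) (n : nat) (x y : G) : Prop :=
  exists p : seq G,
    [/\ path (fun u v => `[< edge u v >]) x p,
        uniq (x :: p : seq {classic G}),
        last x p = y & size p <= n].

Definition Out_set (G : digraph) (n : nat) (A : set G) : set G :=
  [set v | exists2 a, A a & dipath_upto n a v].

Definition In_set (G : digraph) (n : nat) (A : set G) : set G :=
  [set v | exists2 a, A a & dipath_upto n v a].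

Definition Out_class (n : nat) (G : digraph) : Prop :=
  exists2 A : set G, independent A & Out_set n A = [set: G].

Definition In_class (n : nat) (G : digraph) : Prop :=
  exists2 A : set G, independent A & In_set n A = [set: G].

Definition In_Out_class (n k : nat) (G : digraph) : Prop :=
  exists V1 V2 : set G,
    [/\ V1 `|` V2 = [set: G], V1 `&` V2 = set0,
        In_class n (induced V1) & Out_class k (induced V2)].

(* Main.v *)
Require Import Defs.
From mathcomp Require Import all_boot all_classical.

Set Implicit Arguments.
Unset Strict Implicit.
Unset Printing Implicit Defensive.

(** If the independent set [A] is maximal and is not a quasi-kernel, some [u] is
    not within two steps of [A].  Then no out-neighbour of [A] points to [u], so
    every vertex which does not point to [A] is either an out-neighbour of [u]
    or not adjacent to [u].  Hence the vertices split into three sets: [U],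
    those other than [u] that belong or point to [A]; [O], that is [u] with the
    rest of its out-neighbours; and [N], non-neighbours of [u] that do not
    point to [A].  The complement of the graph on [N] has no clique of size
    [n - 1], so induction splits [N] into an In-part with sink [S] and an
    Out-part.  The Out-part joins [O], as [u] is adjacent to nothing in [N].
    The In-part joins [U] by the Chvatal-Lovasz argument: no vertex of [S] points
    to [A], so deleting from [A] the points with an edge to [S] leaves
    a set which together with [S] is independent; the deleted points reach [S]
    in one step. *)

Section QuasiKernels.
Local Open Scope classical_set_scope.
Variable V : Type.
Implicit Types (e : V -> V -> Prop) (W U A : set V) (x y z : V) (k : nat).

Definition converse e : V -> V -> Prop := fun x y => e y x.

(** Walks of length at most [k], repetitions allowed. Every vertex but the endpoint [y] must lie in
    [W], so induction can pass to subsets without changing the vertex type. *)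
Fixpoint reach e W k x y : Prop :=
  if k is k'.+1 then x = y \/ exists z, [/\ W z, reach e W k' x z & e z y]
  else x = y.

Lemma reach_refl e W k x : reach e W k x x.
Proof. by case: k => [|k] //=; left. Qed.

Lemma reach_edge e W k x y : W x -> e x y -> reach e W k.+1 x y.
Proof. by move=> Wx exy; right; exists x; split=> //; apply: reach_refl. Qed.

Lemma reachS e W k x y : W x -> reach e W k x y -> reach e W k.+1 x y.
Proof.
move=> Wx; elim: k y => [y <-|k IHk y]; first exact: reach_refl.
case=> [<-|[z [Wz /IHk xz zy]]]; first exact: reach_refl.
by right; exists z.
Qed.

Lemma reach_sub e W U k x y : W `<=` U -> reach e W k x y -> reach e U k x y.
Proof.
move=> WU; elim: k y => [//|k IHk y] [<-|[z [/WU Uz /IHk xz zy]]].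
  exact: reach_refl.
by right; exists z.
Qed.

Lemma reach_cons e W k x y z :
  W x -> e x y -> reach e W k y z -> reach e W k.+1 x z.
Proof.
move=> Wx exy; elim: k z => [z <-|k IHk z]; first exact: reach_edge.
case=> [<-|[t [Wt /IHk xt tz]]]; first exact: reach_edge.
by right; exists t.
Qed.

Definition indep e A := forall x y, A x -> A y -> x <> y -> ~ e x y.

(* A quasi-kernel for [k = 2]; with [converse e] for [e], a quasi-sink. *)
Definition is_kernel e k W A :=
  [/\ A `<=` W, indep e A & forall v, W v -> exists2 a, A a & reach e W k a v].

Lemma indep_converse e A : indep e A -> indep (converse e) A.
Proof. by move=> iA x y Ax Ay xy; apply: iA => // yx; apply: xy. Qed.

Lemma is_kernelS e k W A : is_kernel e k W A -> is_kernel e k.+1 W A.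
Proof.
move=> [AW iA WA]; split=> // v /WA[a Aa av].
by exists a => //; apply: reachS => //; apply: AW.
Qed.

Lemma is_kernel0 e k : is_kernel e k set0 set0.
Proof. by split=> //. Qed.

Lemma is_kernelU e k U W A B : is_kernel e k U A -> is_kernel e k W B ->
  (forall a b, A a -> B b -> ~ e a b /\ ~ e b a) ->
  is_kernel e k (U `|` W) (A `|` B).
Proof.
move=> [AU iA UA] [BW iB WB] AB; split; first exact: setUSS.
  move=> x y [Ax|Bx] [Ay|By] xy; [exact: iA | | | exact: iB].
  - by case: (AB x y).
  - by case: (AB y x).
move=> v [/UA[a Aa]|/WB[a Aa]] av; exists a.
- by left.
- exact: reach_sub av.
- by right.
- exact: reach_sub av.
Qed.

(** A deleted [a] has an edge from some [s] in [S], so [s] reaches in [k.+1] steps what [a] reaches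
    in [k]. It is applied to [converse e]. *)
Lemma is_kernel_absorb e k U W A S :
  is_kernel e k U A -> is_kernel e k.+1 W S ->
  (forall a s, A a -> S s -> ~ e a s) ->
  is_kernel e k.+1 (U `|` W) ([set a | A a /\ forall s, S s -> ~ e s a] `|` S).
Proof.
move=> [AU iA UA] [SW iS WS] AS; split.
- by move=> x [[/AU]|/SW]; [left | right].
- move=> x y [[Ax nx]|Sx] [[Ay ny]|Sy] xy; [exact: iA | | | exact: iS].
  + exact: AS.
  + exact: ny.
move=> v [/UA[a Aa av]|/WS[s Ss sv]]; last first.
  by exists s; [right | apply: reach_sub sv].
have {}av : reach e (U `|` W) k a v by apply: reach_sub av.
have [[s Ss sa]|nSa] := pselect (exists2 s, S s & e s a).
  by exists s; [right | apply: reach_cons sa av; right; apply: SW].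
exists a; last by apply: reachS => //; left; apply: AU.
by left; split=> // s Ss sa; apply: nSa; exists s.
Qed.

Lemma ex_maximal_indep e W : exists A,
  [/\ A `<=` W, indep e A &
   forall v, W v -> ~ A v -> exists2 a, A a & e a v \/ e v a].
Proof.
pose P A := A `<=` W /\ indep e A.
have [F FP Ftot|A [[AW iA] Amax]] := @Zorn_bigcup V P.
  split=> [x [X /FP[XW _] Xx]|x y [X FX Xx] [Y FY Yy]]; first exact: XW.
  (* Any two points of the union of a chain lie in a common member. *)
  have [XY|YX] := Ftot X Y FX FY.
    by apply: (FP _ FY).2 => //; apply: XY.
  by apply: (FP _ FX).2 => //; apply: YX.
exists A; split=> // v Wv nAv; apply: contrapT => nadj.
apply: (Amax (A `|` [set v])).
  by split=> [x Ax|Av]; [left | apply: nAv; apply: Av; right].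
split=> [x [/AW//|->//]|x y [Ax|->] [Ay|->] xy exy].
- exact: (iA x y).
- by apply: nadj; exists x; [|left].
- by apply: nadj; exists y; [|right].
- by [].
Qed.

(** * Partitions into an In-part and an Out-part, by induction on the clique number *)

Definition In_Out e i k W := exists V1 V2, [/\ V1 `|` V2 = W, V1 `&` V2 = set0,
  exists A, is_kernel (converse e) i V1 A & exists B, is_kernel e k V2 B].

Definition nonadj e x y := [/\ x <> y, ~ e x y & ~ e y x].

(** A clique of the complement is a vertex with a smaller clique among its non-neighbours, which is
    the form the induction consumes. The empty clique always exists, hence [False] at 0. *)
Fixpoint clique_free e n W : Prop :=
  if n is n'.+1 then forall x, W x -> clique_free e n' (W `&` nonadj e x)
  else False.

Lemma clique_free_sub e n W U : W `<=` U -> clique_free e n U ->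
  clique_free e n W.
Proof.
elim: n W U => [//|n IHn] W U WU /= freeU x Wx.
by apply: IHn (freeU x (WU x Wx)); apply: setSI.
Qed.

Lemma kernel_or_split e W : (exists A, is_kernel e 2 W A) \/
  exists u A U O N,
   [/\ W u, N `<=` W `&` nonadj e u, W = U `|` O `|` N,
       [/\ U `&` O = set0, U `&` N = set0 & O `&` N = set0] &
       [/\ is_kernel (converse e) 1 U A, is_kernel e 1 O [set u] &
           forall a x, A a -> N x -> ~ e x a]].
Proof.
have [A [AW iA maxA]] := ex_maximal_indep e W.
have [kA|nkA] := pselect (is_kernel e 2 W A); first by left; exists A.
right; have [u Wu nu] : exists2 u, W u & forall a, A a -> ~ reach e W 2 a u.
  apply: contrapT => nou; apply: nkA; split=> // v Wv.
  apply: contrapT => nv; apply: nou; exists v => // a Aa av.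
  by apply: nv; exists a.
have nAu : ~ A u by move=> /nu; apply; apply: reach_refl.
have nAeu a : A a -> ~ e a u.
  by move=> Aa au; apply: (nu a Aa); apply: reach_edge => //; apply: AW.
pose I x := A x \/ exists2 a, A a & e x a.
(* By maximality [x] is adjacent to some [a] in [A]; as [x] does not point to [a], the walk from [a]
   through [x] would reach [u] in two steps. *)
have notI x : W x -> ~ I x -> ~ e x u.
  move=> Wx nIx xu; have [|a Aa [ax|xa]] := maxA x Wx.
  - by move=> Ax; apply: nIx; left.
  - apply: (nu a Aa); right; exists x; split=> //.
    by apply: reach_edge => //; apply: AW.
  - by apply: nIx; right; exists a.
have Iu : I u.
  have [a Aa [au|ua]] := maxA u Wu nAu; first by case: (nAeu a).
  by right; exists a.
exists u, A, [set x | [/\ W x, x <> u & I x]].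
exists [set x | x = u \/ [/\ W x, ~ I x & e u x]].
exists [set x | [/\ W x, ~ I x & nonadj e u x]].
split=> //.
- by move=> x [].
- apply/seteqP; split=> [x Wx|x [[[]|[->|[]]]|[]]] //.
  have [->|xu] := pselect (x = u); first by left; right; left.
  have [Ix|nIx] := pselect (I x); first by left; left.
  have nxu := notI x Wx nIx.
  have [ux|nux] := pselect (e u x); first by left; right; right.
  by right; split=> //; split=> // /esym.
- split; apply/seteqP; split=> x //.
  + by case=> -[_ xu Ix] [|[]].
  + by case=> -[_ xu Ix] [].
  + by case=> -[->|[_ _ ux]] [_ nIx []].
- split.
  + split; [|exact: indep_converse|].
      move=> x Ax; split; [exact: AW | | by left].
      by move=> xu; apply: nAu; rewrite -xu.
    move=> v [Wv vu [Av|[a Aa va]]]; first by exists v => //; apply: reach_refl.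
    exists a => //; apply: reach_edge => //; split; [exact: AW | | by left].
    by move=> au; apply: nAu; rewrite -au.
  + split=> [x ->|x y -> ->|v [->|[_ _ uv]]]; [by left | by [] | | ].
      by exists u => //; apply: reach_refl.
    by exists u => //; apply: reach_edge => //; left.
  + by move=> a x Aa [_ nIx _] xa; apply: nIx; right; exists a.
Qed.

(** If [N] has a kernel, all of it joins [O] and the In-bound stays 1. If [N] is only partitioned,
    absorbing its sink raises the In-bound of [U] to 2. *)
Lemma In_Out_glue e k u A U O N W :
  N `<=` nonadj e u -> W = U `|` O `|` N ->
  [/\ U `&` O = set0, U `&` N = set0 & O `&` N = set0] ->
  [/\ is_kernel (converse e) 1 U A, is_kernel e 1 O [set u] &
      forall a x, A a -> N x -> ~ e x a] ->
  (0 < k)%N ->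
  ((exists B, is_kernel e k N B) -> In_Out e 1 k W) /\
  (In_Out e 2 k N -> In_Out e 2 k W).
Proof.
case: k => // k Nu -> [UO UN ON] [kU kO NA] _.
have {}kO : is_kernel e k.+1 O [set u].
  by elim: k => [//|k IHk]; apply: is_kernelS.
have joinO R B : R `<=` N -> is_kernel e k.+1 R B ->
    is_kernel e k.+1 (O `|` R) ([set u] `|` B).
  move=> RN kB; apply: is_kernelU => // _ b -> Bb.
  by have [BR _ _] := kB; have [] := Nu _ (RN _ (BR _ Bb)).
split=> [[B kB]|[V1 [V2 [V12 V12d [S kS] [B kB]]]]].
  exists U, (O `|` N); split; first by rewrite setUA.
  - by rewrite setIUr UO UN setU0.
  - by exists A.
  - by exists ([set u] `|` B); apply: joinO.
have V1N : V1 `<=` N by rewrite -V12; left.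
have V2N : V2 `<=` N by rewrite -V12; right.
exists (U `|` V1), (O `|` V2); split.
- by rewrite -V12 setUACA setUA.
- rewrite setIUl !setIUr UO V12d set0U setU0.
  apply/seteqP; split=> // x [[Ux /V2N Nx]|[/V1N Nx Ox]].
    by rewrite -UN.
  by rewrite -ON.
- eexists; apply: (is_kernel_absorb kU kS) => a s Aa Ss.
  by have [SV1 _ _] := kS; apply: NA => //; apply: V1N; apply: SV1.
- by exists ([set u] `|` B); apply: joinO.
Qed.

Lemma In_Out_kernel e i k W A : is_kernel e k W A -> In_Out e i k W.
Proof.
move=> kA; exists set0, W; split; rewrite ?set0U ?set0I //.
  by exists set0; apply: is_kernel0.
by exists A.
Qed.

Lemma In_OutSl e i k W : In_Out e i k W -> In_Out e i.+1 k W.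
Proof.
move=> [V1 [V2 [V12 d [A kA] kB]]]; exists V1, V2; split=> //.
by exists A; apply: is_kernelS.
Qed.

Lemma clique_free_In_Out e n W : clique_free e n W -> In_Out e 2 2 W.
Proof.
elim: n W => [//|n IHn] W freeW.
have [[A kA]|[u [A [U [O [N [Wu NWu eqW d kers]]]]]]] := kernel_or_split e W.
  exact: In_Out_kernel kA.
have Nu : N `<=` nonadj e u by move=> x /NWu[].
apply: (In_Out_glue (k := 2) Nu eqW d kers isT).2; apply: IHn.
exact: clique_free_sub NWu (freeW u Wu).
Qed.

Lemma clique_free2_In_Out e W : clique_free e 2 W ->
  (exists A, is_kernel e 2 W A) \/ In_Out e 1 1 W.
Proof.
move=> freeW; have [kW|[u [A [U [O [N [Wu NWu eqW d kers]]]]]]] :=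
  kernel_or_split e W; [by left | right].
have Nu : N `<=` nonadj e u by move=> x /NWu[].
(* A point of [N] would form a 2-clique with [u]. *)
have N0 : N = set0.
  by apply/seteqP; split=> x // /NWu Nx; case: (freeW u Wu x Nx).
apply: (In_Out_glue (k := 1) Nu eqW d kers isT).1.
by exists set0; rewrite N0; apply: is_kernel0.
Qed.

(** The set [N] has no 2-clique, so the previous case applies to it; its two outcomes feed the two
    halves of the gluing lemma. *)
Lemma clique_free3_In_Out e W : clique_free e 3 W ->
  In_Out e 1 2 W \/ In_Out e 2 1 W.
Proof.
move=> freeW; have [[A kA]|[u [A [U [O [N [Wu NWu eqW d kers]]]]]]] :=
  kernel_or_split e W; first by left; apply: In_Out_kernel kA.
have Nu : N `<=` nonadj e u by move=> x /NWu[].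
have freeN := clique_free_sub (n := 2) NWu (freeW u Wu).
have [kN|ioN] := clique_free2_In_Out freeN.
  by left; apply: (In_Out_glue (k := 2) Nu eqW d kers isT).1.
by right; apply: (In_Out_glue (k := 1) Nu eqW d kers isT).2; apply: In_OutSl.
Qed.

Lemma not_clique_free e n W : ~ clique_free e n W ->
  exists s : seq V, [/\ size s = n, forall i x0, i < n -> W (nth x0 s i) &
    forall x0 i j, i < j -> j < n -> nonadj e (nth x0 s i) (nth x0 s j)].
Proof.
elim: n W => [W _|n IHn W /existsNP[x /not_implyP[Wx /IHn[s [ss sW sn]]]]].
  by exists [::].
exists (x :: s); split; first by rewrite /= ss.
  by case=> [//|i] x0 /= /(sW i x0)[].
move=> x0 [|i] [|j] //= ij jn; last exact: sn.
by have [] := sW j x0 jn.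
Qed.

End QuasiKernels.

(** * From walks to directed paths without repetition *)

Section Dipaths.
Local Open Scope classical_set_scope.
Variable G : digraph.
Implicit Types (x y z : G) (W A : set G) (k : nat).

(** Loop erasure keeps the endpoints and does not lengthen the walk. *)
Lemma dipath_shorten k (x : {classic G}) (p : seq {classic G}) :
  path (fun u v : G => `[< edge u v >]) x p -> size p <= k ->
  dipath_upto k (x : G) (last x p).
Proof.
move=> xp pk; case: (@shortenP {classic G} _ _ _ xp) => q xq uq qp.
exists q; split=> //; apply: leq_trans pk.
by apply: uniq_leq_size => //; case/andP: uq.
Qed.

Lemma dipath_refl k x : dipath_upto k x x.
Proof. by exists [::]. Qed.

Lemma dipath_rcons k x y z :
  dipath_upto k x y -> edge y z -> dipath_upto k.+1 x z.
Proof.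
move=> [p [xp _ lp pk]] yz.
have := @dipath_shorten k.+1 x (rcons p z); rewrite last_rcons; apply.
  by rewrite rcons_path xp lp; apply/asboolP.
by rewrite size_rcons.
Qed.

Lemma dipath_cons k x y z :
  edge x y -> dipath_upto k y z -> dipath_upto k.+1 x z.
Proof.
move=> xy [p [yp _ <- pk]].
have := @dipath_shorten k.+1 x (y :: p); apply=> //.
by rewrite /= yp andbT; apply/asboolP.
Qed.

Lemma reach_dipath W k x y : reach (@edge G) W k x y -> dipath_upto k x y.
Proof.
elim: k y => [y <-|k IHk y]; first exact: dipath_refl.
case=> [<-|[z [_ /IHk xz]]]; [exact: dipath_refl | exact: dipath_rcons].
Qed.

Lemma reach_converse_dipath W k x y :
  reach (converse (@edge G)) W k x y -> dipath_upto k y x.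
Proof.
elim: k y => [y <-|k IHk y]; first exact: dipath_refl.
case=> [<-|[z [_ /IHk zx yz]]]; [exact: dipath_refl | exact: dipath_cons zx].
Qed.

Lemma kernel_Out_class k A : is_kernel (@edge G) k setT A -> Out_class k G.
Proof.
move=> [_ iA GA]; exists A => //; apply/seteqP; split=> // v _.
by have [a Aa /reach_dipath] := GA v I; exists a.
Qed.

Lemma kernel_In_class k A :
  is_kernel (converse (@edge G)) k setT A -> In_class k G.
Proof.
move=> [_ iA GA]; exists A; first exact: indep_converse.
apply/seteqP; split=> // v _.
by have [a Aa /reach_converse_dipath] := GA v I; exists a.
Qed.

End Dipaths.

(** * Transfer to induced subgraphs and to copies of complete graphs *)

Section Induced.
Local Open Scope classical_set_scope.

Lemma is_kernel_set_type (V : Type) (e : V -> V -> Prop) k (W A : set V) :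
  is_kernel e k W A ->
  is_kernel (fun x y : set_type W => e (val x) (val y)) k setT
    [set x | A (val x)].
Proof.
move=> [AW iA WA]; split=> // [x y Ax Ay xy|v _].
  by apply: iA => // /val_inj.
(* The inner vertices lie in [W], so the walk lifts vertex by vertex. *)
have lift j (x y : set_type W) : reach e W j (val x) (val y) ->
    reach (fun x y : set_type W => e (val x) (val y)) setT j x y.
  elim: j y => [y /val_inj//|j IHj y [/val_inj ->|[z [Wz xz zy]]]].
    exact: reach_refl.
  right; exists (exist _ z (mem_set Wz)); split=> //; exact: IHj.
have [a Aa av] := WA (val v) (set_valP v).
by exists (exist _ a (mem_set (AW a Aa))) => //; apply: lift.
Qed.

Lemma In_Out_In_Out_class (G : digraph) i k :
  In_Out (@edge G) i k setT -> In_Out_class i k G.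
Proof.
move=> [V1 [V2 [V12 d [A kA] [B kB]]]]; exists V1, V2; split=> //.
  exact: (@kernel_In_class (induced V1) _ _ (is_kernel_set_type kA)).
exact: (@kernel_Out_class (induced V2) _ _ (is_kernel_set_type kB)).
Qed.

Lemma no_copy_clique_free (G : digraph) n :
  ~ has_copy (complete_graph n) (undirected_complement G) ->
  clique_free (@edge G) n setT.
Proof.
move=> noK; apply: contrapT => /not_clique_free[s [ss _ sn]]; apply: noK.
(* For [n = 0] the graph may have no vertex to serve as the default of [nth]. *)
case: n ss sn => [|n] ss sn.
  by exists (fun i : 'I_0 => False_rect G (notF (ltn_ord i))) => -[].
case: s ss sn => [//|x0 s] _ sn.
pose f (i : complete_graph n.+1) := nth x0 (x0 :: s) (i : 'I_n.+1).
have fadj (i j : 'I_n.+1) : i <> j -> compl_adj (f i) (f j).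
  move=> ij; have [lij|lji|/val_inj//] := ltngtP i j.
    exact: (sn x0 i j lij).
  exact/compl_adj_sym/(sn x0 j i lji).
exists f => [i j fij|i j ij]; last exact: fadj.
(* Injectivity comes from irreflexivity: distinct indices have adjacent, hence distinct, images. *)
by apply: contrapT => /fadj; rewrite fij => -[].
Qed.

End Induced.

Theorem theorem3p2 (G : digraph) (n : nat) (hn : 2 <= n)
    (hK : ~ has_copy (complete_graph n) (undirected_complement G)) :
  [/\ In_Out_class 2 2 G,
      n = 2 -> Out_class 2 G \/ In_Out_class 1 1 G &
      n = 3 -> In_Out_class 1 2 G \/ In_Out_class 2 1 G].
Proof.
have free := no_copy_clique_free hK; split=> [|n2|n3].
- exact: In_Out_In_Out_class (clique_free_In_Out free).
- rewrite n2 in free.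
  have [[A kA]|io] := clique_free2_In_Out free.
    by left; apply: kernel_Out_class kA.
  by right; apply: In_Out_In_Out_class.
- rewrite n3 in free.
  by have [io|io] := clique_free3_In_Out free; [left|right];
    apply: In_Out_In_Out_class.
Qed.
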